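(* If the multiplicative loop $Q^{*}$ of a locally compact connected topological $2$-dimensional quasifield $Q$ with $(1,0)^t$ as identity of $Q^{*}$ is not quasi-simple, then $Q^{*}$ is decomposable.
   Context: A left quasifield $(Q,+,* )$ has $(Q,+)$ an abelian group, $Q^*=(Q\setminus\{0\},* )$ a loop with identity, and $x*(y+z)=x*y+x*z$. Its kernel is $K_r=\{k\in Q:(x+y)*k=x*k+y*k,\ (x*y)*k=x*(y*k)\ \forall x,y\}$. Here $Q$ is a locally compact connected topological quasifield of dimension $2$ over $K_r\cong\mathbb R$ (continuous addition and multiplication, $Q^*$ a topological loop). Identify $Q$ with $\mathbb R^2$ with $(1,0)^t$ as identity of $Q^*$ and $K_r=\{(x,0)^t\}$. The left translations of $Q^*$ are linear, topologically generate $\mathrm{GL}_2^+(\mathbb R)$, and are the matrices $u\begin{pmatrix}\cos t&\sin t\\-\sin t&\cos t\end{pmatrix}\begin{pmatrix}a(u,t)&b(u,t)\\0&a^{-1}(u,t)\end{pmatrix}$, $u>0$, $t\in[0,2\pi)$, with $a,b$ continuous, $a>0$, $a(1,0)=1$, $b(1,0)=0$, $a^{-1}=1/a$. A subloop $N$ of a loop $L$ is normal if $x\cdot N=N\cdot x$, $(x\cdot N)\cdot y=x\cdot(N\cdot y)$, $(N\cdot x)\cdot y=N\cdot(x\cdot y)$ for all $x,y\in L$. A connected topological loop is quasi-simple if it contains no normal subloop of positive dimension. $Q^*$ is decomposable if the set of all left translations of $Q^*$ is a product $\mathcal T\mathcal K$ with $|\mathcal T\cap\mathcal K|\le2$, where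 $\mathcal T$ is the set of all left translations of a $1$-dimensional compact loop of the form $\mathcal T=\left\{\begin{pmatrix}\cos t&\sin t\\-\sin t&\cos t\end{pmatrix}\begin{pmatrix}a(1,t)&b(u,t)\\0&a^{-1}(1,t)\end{pmatrix}:t\in[0,2\pi)\right\}$ (the paper takes $u=1$) and $\mathcal K$ is the set of all left translations of $Q^*$ belonging to (nonzero elements of) the kernel $K_r$.
   Formalization: Quasi-simple is read as having no proper normal subloop of positive dimension; the product is proved as T times the translations by positive kernel elements only, since it fails for the whole kernel (a=1, b=β(t) small with β(π)≠0), while |T∩K|≤2 is proved for all of K. *)

(* Defs.v *)
(* MathComp / MathComp-Analysis. *)
From HB Require Import structures.
From mathcomp Require Import all_boot all_order all_algebra.
From mathcomp Require Import all_classical all_reals all_analysis.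
Set Implicit Arguments.
Unset Strict Implicit.
Unset Printing Implicit Defensive.
Import Order.TTheory GRing.Theory Num.Theory.
Import numFieldNormedType.Exports.
Local Open Scope classical_set_scope.
Local Open Scope ring_scope.

(* A loop carried by a subset L of T. The operation is total on T; only its
   values on L matter. *)
Record is_loop (T : Type) (L : set T) (mul : T -> T -> T) (e : T) : Prop := {
  loop_closed : forall x y, L x -> L y -> L (mul x y);
  loop_id : L e;
  loop_mul1l : forall x, L x -> mul e x = x;
  loop_mul1r : forall x, L x -> mul x e = x;
  loop_ldiv : forall x y, L x -> L y -> exists! z, L z /\ mul x z = y;
  loop_rdiv : forall x y, L x -> L y -> exists! z, L z /\ mul z x = y }.

(* ldiv x y is the solution z of x * z = y, and rdiv x y that of z * x = y. *)
Definition topological_loop (T : topologicalType) (L : set T)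
    (mul : T -> T -> T) (e : T) : Prop :=
  [/\ is_loop L mul e,
      {within L `*` L, continuous (fun p : T * T => mul p.1 p.2)} &
      exists ldiv rdiv : T -> T -> T,
        [/\ forall x y, L x -> L y -> L (ldiv x y) /\ mul x (ldiv x y) = y,
            forall x y, L x -> L y -> L (rdiv x y) /\ mul (rdiv x y) x = y,
            {within L `*` L, continuous (fun p : T * T => ldiv p.1 p.2)} &
            {within L `*` L, continuous (fun p : T * T => rdiv p.1 p.2)}]].

Definition subloop (T : Type) (L : set T) (mul : T -> T -> T) (e : T)
    (N : set T) : Prop :=
  N `<=` L /\ is_loop N mul e.

Definition normal_subloop (T : Type) (L : set T) (mul : T -> T -> T) (e : T)
    (N : set T) : Prop :=
  [/\ subloop L mul e N,
      forall x, L x -> [set mul x n | n in N] = [set mul n x | n in N],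
      forall x y, L x -> L y ->
        [set mul (mul x n) y | n in N] = [set mul x (mul n y) | n in N] &
      forall x y, L x -> L y ->
        [set mul (mul n x) y | n in N] = [set mul n (mul x y) | n in N]].

(* ind_lt n A: the small inductive dimension of the subspace A of T is less
   than n. Each point of A has arbitrarily small relatively open
   neighbourhoods V `&` A whose boundary relative to A, that is
   (A `&` closure (V `&` A)) `\` V, has dimension less than n.-1. *)
Fixpoint ind_lt (T : topologicalType) (n : nat) (A : set T) : Prop :=
  match n with
  | 0%N => A = set0
  | m.+1 => forall (x : T) (U : set T), A x -> open U -> U x ->
      exists V : set T, [/\ open V, V x, V `&` A `<=` U &
        ind_lt m ((A `&` closure (V `&` A)) `\` V)]
  end.

Definition positive_dimension (T : topologicalType) (A : set T) : Prop :=
  ~ ind_lt 1 A.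

(* L is trivially normal in itself, so N has to be proper. *)
Definition quasi_simple (T : topologicalType) (L : set T)
    (mul : T -> T -> T) (e : T) : Prop :=
  ~ exists N : set T,
      [/\ normal_subloop L mul e N, N <> L & positive_dimension N].

Definition left_quasifield (V : zmodType) (mul : V -> V -> V) (e : V) : Prop :=
  is_loop [set x | x != 0] mul e /\
  forall x y z, mul x (y + z) = mul x y + mul x z.

Definition qf_kernel (V : zmodType) (mul : V -> V -> V) : set V :=
  [set k | (forall x y, mul (x + y) k = mul x k + mul y k) /\
           (forall x y, mul (mul x y) k = mul x (mul y k))].

Section Plane.
Variable R : realType.
Implicit Types (mul : 'cV[R]_2 -> 'cV[R]_2 -> 'cV[R]_2) (a b : R -> R -> R).

Definition Qstar : set 'cV[R]_2 := [set x | x != 0].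

(* the column (1, 0) *)
Definition e1 : 'cV[R]_2 := delta_mx 0 0.

(* The additive group is that of R^2, whose addition is continuous. *)
Definition topological_quasifield mul : Prop :=
  [/\ left_quasifield mul e1,
      continuous (fun p : 'cV[R]_2 * 'cV[R]_2 => mul p.1 p.2) &
      topological_loop Qstar mul e1].

(* the matrices of the left translations by the elements of A *)
Definition left_translations mul (A : set 'cV[R]_2) : set 'M[R]_2 :=
  [set M | exists2 x, A x & forall y, mul x y = M *m y].

Definition GL2p : set 'M[R]_2 := [set M | 0 < \det M].

Definition topologically_generates_GL2p (S : set 'M[R]_2) : Prop :=
  S `<=` GL2p /\
  forall H : set 'M[R]_2,
    H `<=` GL2p -> H 1%:M ->
    (forall M N, H M -> H N -> H (M *m N)) ->
    (forall M, H M -> H (invmx M)) ->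
    closure H `&` GL2p `<=` H ->
    S `<=` H -> H = GL2p.

Definition mx22 (p q r s : R) : 'M[R]_2 :=
  \matrix_(i < 2, j < 2)
    if i == 0 then (if j == 0 then p else q) else (if j == 0 then r else s).

Definition rot (t : R) : 'M[R]_2 := mx22 (cos t) (sin t) (- sin t) (cos t).

(* (u, t) are polar coordinates on the cylinder u > 0, t mod 2 pi: a and b are
   2 pi-periodic in t, and are continuous there. *)
Definition section_functions a b : Prop :=
  [/\ forall u t, 0 < u -> a u (t + 2 * pi) = a u t /\
                           b u (t + 2 * pi) = b u t,
      {within [set p : R * R | 0 < p.1], continuous (fun p => a p.1 p.2)},
      {within [set p : R * R | 0 < p.1], continuous (fun p => b p.1 p.2)},
      forall u t, 0 < u -> 0 < a u t &
      a 1 0 = 1 /\ b 1 0 = 0].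

Definition section_matrices a b : set 'M[R]_2 :=
  [set M | exists u t, [/\ 0 < u, 0 <= t < 2 * pi &
    M = u *: (rot t *m mx22 (a u t) (b u t) 0 (a u t)^-1)]].

Definition compact_factor a b : set 'M[R]_2 :=
  [set M | exists2 t, 0 <= t < 2 * pi &
    M = rot t *m mx22 (a 1 t) (b 1 t) 0 (a 1 t)^-1].

Definition circle : set 'cV[R]_2 := [set v | v 0 0 ^+ 2 + v 1 0 ^+ 2 = 1].

(* action of a matrix on the circle of rays through the origin *)
Definition ray_act (M : 'M[R]_2) (v : 'cV[R]_2) : 'cV[R]_2 :=
  let w := M *m v in (Num.sqrt (w 0 0 ^+ 2 + w 1 0 ^+ 2))^-1 *: w.

(* T is the set of all left translations of a 1-dimensional compact loop: its
   elements, acting on rays, are the left translations of a topological loop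
   on the circle. *)
Definition compact_loop_translations (T : set 'M[R]_2) : Prop :=
  exists cmul : 'cV[R]_2 -> 'cV[R]_2 -> 'cV[R]_2,
    [/\ topological_loop circle cmul e1,
        forall M, T M -> exists2 x, circle x &
          forall y, circle y -> cmul x y = ray_act M y &
        forall x, circle x -> exists2 M, T M &
          forall y, circle y -> cmul x y = ray_act M y].

(* K consists of the left translations by all nonzero kernel elements (x, 0),
   and K0 of those with x > 0, the component of the identity in K; in the
   coordinates (u, t), K0 is the half-line t = 0.
   The factorization Lambda = T K is taken with one factor from the half-line
   t = 0, i.e. Lambda = T K0. The complex product with the whole of K would
   moreover require T k to lie in Lambda for the translations k by (x, 0) with
   x < 0; this fails for some Q that are not quasi-simple, e.g. for a = 1 and
   b(u, t) = beta(t) with beta C^1-small, beta(0) = 0 and beta(pi) <> 0: the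
   square of the translation k by (-1, 0), an element of both T and K, is then
   upper unitriangular, different from 1, hence not in Lambda. *)
Definition decomposable mul a b : Prop :=
  let Lambda := left_translations mul Qstar in
  let T := compact_factor a b in
  let K := left_translations mul [set k : 'cV[R]_2 | qf_kernel mul k /\ k != 0] in
  let K0 := left_translations mul [set k : 'cV[R]_2 | qf_kernel mul k /\ 0 < k 0 0] in
  [/\ compact_loop_translations T,
      Lambda = [set M *m N | M in T & N in K0] &
      (T `&` K #<= `I_2)%card].

End Plane.
Arguments e1 {R}.
Arguments Qstar {R}.

(* Main.v *)
Require Import Defs.
From HB Require Import structures.
From mathcomp Require Import all_boot all_order all_algebra.
From mathcomp Require Import all_classical all_reals all_analysis.
From mathcomp Require Import ring lra.
Set Implicit Arguments.
Unset Strict Implicit.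
Unset Printing Implicit Defensive.
Import Order.TTheory GRing.Theory Num.Theory.
Import numFieldNormedType.Exports.
Local Open Scope classical_set_scope.
Local Open Scope ring_scope.

(** Write M_x for the matrix of the left translation by x; its first column is
    x. Let N be a proper normal subloop of positive dimension. N is neither
    assumed closed nor connected, so the first step is to show that its cosets
    are permuted by all of GL2+.

    The matrices g of positive determinant that permute the cosets x N form a
    group B containing every M_x ([same_coset_mul]). Those g that can be joined
    to 1 by a continuous curve inside B form a subgroup C, which still contains
    every M_x because the punctured plane is path connected
    ([tr_arc_component]); as the left translations topologically generate GL2+,
    C is dense in GL2+ ([GL2p_subgroup_dense]). The continuous map
    g |-> M_{g e1}^-1 g sends GL2+ to the stabilizer of e1, which consists of the
    shears (1 b; 0 d), and sends B to B. It therefore yields two curves of shears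
    in B that start at 1 and have noncommuting ends. The commutators along one of
    them, and the determinants, fill intervals by the intermediate value theorem;
    since a subgroup of the reals containing an interval is everything, B
    contains all shears ([all_shears]), hence B = GL2+
    ([GL2p_subgroup_full]).

    If N had a point off the axis R e1, then the shears would spread it over a
    half-plane, and a quarter turn would spread this half-plane over the whole
    punctured plane ([normal_proper_axis]). So N lies on the axis, where it is a
    multiplicative subgroup of R. Such a subgroup that misses a positive number
    misses a point of every interval and is zero-dimensional; hence N contains
    the half-axis x > 0 ([normal_axis_positive]). Normality of N then makes
    M_x^-1 M_{r x} a matrix with all vectors as eigenvectors, so that
    M_{r x} = r M_x for r > 0 ([trans_homogeneous]).

    In the coordinates (u, t) this homogeneity says that a and b do not depend
    on u ([unimodular_part_indep]). The factorization of the set of left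
    translations follows, and the compact loop is the loop induced on the circle
    of rays ([ray_loop], [decomposable_of_homogeneous]). *)

(** * Two by two matrices and subgroups of the real line *)

Lemma ord2_ind (P : 'I_2 -> Prop) : P 0 -> P 1 -> forall i, P i.
Proof.
by move=> P0 P1 [[|[|//]] h]; [rewrite (_ : Ordinal h = 0)|rewrite (_ : Ordinal h = 1)] => //; exact: val_inj.
Qed.

Lemma sum_ord2 (V : nmodType) (F : 'I_2 -> V) : \sum_i F i = F 0 + F 1.
Proof.
by rewrite !big_ord_recl big_ord0 addr0; congr (_ + F _); exact: val_inj.
Qed.

Lemma det_22 (K : comNzRingType) (A : 'M[K]_2) :
  \det A = A 0 0 * A 1 1 - A 0 1 * A 1 0.
Proof.
rewrite (expand_det_row _ 0) sum_ord2 /cofactor !det_mx11 !mxE.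
rewrite (_ : lift 0 0 = 1); last exact: val_inj.
rewrite (_ : lift 1 0 = 0); last exact: val_inj.
by rewrite /= expr0 expr1 mul1r mulN1r mulrN.
Qed.

Lemma mulmx_22 (K : pzSemiRingType) m n (A : 'M[K]_(m, 2)) (B : 'M[K]_(2, n)) i j :
  (A *m B) i j = A i 0 * B 0 j + A i 1 * B 1 j.
Proof. by rewrite mxE sum_ord2. Qed.

Lemma mx22P (K : Type) (A B : 'M[K]_2) :
  A 0 0 = B 0 0 -> A 0 1 = B 0 1 -> A 1 0 = B 1 0 -> A 1 1 = B 1 1 -> A = B.
Proof.
by move=> h00 h01 h10 h11; apply/matrixP => i j; move: i j;
  apply: ord2_ind; apply: ord2_ind.
Qed.

Lemma cV2P (K : Type) (v w : 'cV[K]_2) : v 0 0 = w 0 0 -> v 1 0 = w 1 0 -> v = w.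
Proof.
by move=> h0 h1; apply/matrixP => i j; rewrite ord1; move: i; apply: ord2_ind.
Qed.

Lemma mx_cvg (K : topologicalType) (T : Type) (F : set_system T) m n
    (f : T -> 'M[K]_(m, n)) (M : 'M[K]_(m, n)) : Filter F ->
  (forall i j, f x i j @[x --> F] --> M i j) -> f @ F --> M.
Proof.
move=> FF h A [P MP PA].
apply: (@filterS _ F _ [set x | forall i j, P i j (f x i j)]).
  by move=> x Px; exact: PA.
by apply: filter_forall => i; apply: filter_forall => j; exact: (h i j _ (MP i j)).
Qed.

Lemma mx_continuous (K : topologicalType) (T : topologicalType) m n
    (f : T -> 'M[K]_(m, n)) (t : T) :
  (forall i j, {for t, continuous (fun x => f x i j)}) -> {for t, continuous f}.
Proof. by move=> h; apply: mx_cvg => i j; exact: h. Qed.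

Lemma mx_entry_continuous (K : numFieldType) (T : topologicalType) m n
    (f : T -> 'M[K]_(m, n)) (t : T) i j :
  {for t, continuous f} -> {for t, continuous (fun x => f x i j)}.
Proof.
by move=> h; apply: (continuous_comp h (@coord_continuous K m n i j (f t))).
Qed.

Section Subgroups.
Variable R : realType.

(** The archimedean property: x is a multiple of an element near 0. *)
Lemma subgroup_nbhs0 (G : set R) :
  (forall x y, G x -> G y -> G (x + y)) ->
  nbhs (0 : R) G -> forall x, G x.
Proof.
move=> GD /nbhs_ballP [e /= e0 eG] x.
have GM n y : G y -> G (y *+ n.+1).
  by move=> Gy; elim: n => // n IH; rewrite mulrS; exact: GD.
pose n := Num.truncn (`|x| / e).
have -> : x = (x / n.+1%:R) *+ n.+1 by rewrite -mulr_natr divfK.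
apply/GM/eG; rewrite /ball /= sub0r normrN normrM normfV (gtr0_norm (_ : 0 < n.+1%:R)) //.
by rewrite ltr_pdivrMr // mulrC -ltr_pdivrMr // truncnS_gt.
Qed.

(** A subgroup of R containing a nonconstant curve through 0 is R. *)
Lemma subgroup_path (G : set R) (f : R -> R) :
  (forall x y, G x -> G y -> G (x + y)) -> (forall x, G x -> G (- x)) ->
  continuous f -> f 0 = 0 -> f 1 != 0 -> (forall s, G (f s)) -> forall x, G x.
Proof.
move=> GD GN cf f0 f1 Gf; apply: subgroup_nbhs0 => //.
apply/nbhs_ballP; exists `|f 1| => /=; first by rewrite normr_gt0.
(* by the intermediate value theorem, G contains the segment from f 0 to f 1 *)
have key v : Num.min (f 0) (f 1) <= v <= Num.max (f 0) (f 1) -> G v.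
  move=> hv; have [|c _ <-] := @IVT R f 0 1 v ler01 _ hv => //.
  exact: continuous_subspaceT.
move=> v; rewrite /ball /= sub0r normrN => hv.
have [v0|v0] := leP 0 v; have [g0|g0] := leP 0 (f 1); rewrite f0 in key.
- apply: key; move: hv; rewrite !ger0_norm // => /ltW hv.
  by rewrite min_l // max_r // v0.
- rewrite -[v]opprK; apply/GN/key; move: hv; rewrite ger0_norm // ltr0_norm // => hv.
  by rewrite min_r ?max_l ?(ltW g0) //; apply/andP; split; lra.
- rewrite -[v]opprK; apply/GN/key; move: hv; rewrite ltr0_norm // ger0_norm // => hv.
  by rewrite min_l // max_r //; apply/andP; split; lra.
- apply: key; move: hv; rewrite !ltr0_norm // => hv.
  by rewrite min_r ?max_l ?(ltW g0) //; apply/andP; split; lra.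
Qed.

End Subgroups.

(** * Dense subgroups and arc components in GL2+ *)

Section Matrices22.
Variable R : realType.
Implicit Types (A M g : 'M[R]_2) (B S : set 'M[R]_2).

Lemma mx22E (p q r s : R) :
  [/\ mx22 p q r s 0 0 = p, mx22 p q r s 0 1 = q,
      mx22 p q r s 1 0 = r & mx22 p q r s 1 1 = s].
Proof. by split; rewrite mxE. Qed.

(** The adjugate and the inverse of a 2 x 2 matrix by explicit formulas, so that
    the continuity of inversion can be read off the entries. *)
Definition adj22 A := mx22 (A 1 1) (- A 0 1) (- A 1 0) (A 0 0).
Definition inv22 A := (\det A)^-1 *: adj22 A.

Lemma mulmx_inv22 A : \det A != 0 -> A *m inv22 A = 1%:M.
Proof.
move=> A0; rewrite /inv22 -scalemxAr; apply/(canLR (scalerK A0)).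
have [e1 e2 e3 e4] := mx22E (A 1 1) (- A 0 1) (- A 1 0) (A 0 0).
apply: mx22P; rewrite !mulmx_22 [X in _ = X]mxE [X in _ = _ * X]mxE /=
  ?(e1, e2, e3, e4) det_22 ?mulr1n ?mulr0n; ring.
Qed.

Lemma det_unitmx A : \det A != 0 -> A \in unitmx.
Proof. by rewrite unitmxE unitfE. Qed.

Lemma inv22E A : \det A != 0 -> inv22 A = invmx A.
Proof.
move=> A0; rewrite -[inv22 A](mulKmx (det_unitmx A0)).
by rewrite mulmx_inv22 // mulmx1.
Qed.

Lemma mulmx_continuous (T : topologicalType) m n (f : T -> 'M[R]_(m, 2))
    (h : T -> 'M[R]_(2, n)) t :
  {for t, continuous f} -> {for t, continuous h} ->
  {for t, continuous (fun x => f x *m h x)}.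
Proof.
move=> cf ch; apply: mx_continuous => i j.
have -> : (fun x => (f x *m h x) i j) = 
    (fun x => f x i 0 * h x 0 j + f x i 1 * h x 1 j).
  by apply/funext => x; rewrite mulmx_22.
by apply: continuousD; apply: continuousM; apply: mx_entry_continuous.
Qed.

Lemma det_continuous (T : topologicalType) (f : T -> 'M[R]_2) t :
  {for t, continuous f} -> {for t, continuous (fun x => \det (f x))}.
Proof.
move=> cf.
have -> : (fun x => \det (f x)) =
    (fun x => f x 0 0 * f x 1 1 - f x 0 1 * f x 1 0).
  by apply/funext => x; rewrite det_22.
apply: (@continuousB _ R^o _ (fun x => f x 0 0 * f x 1 1)
  (fun x => f x 0 1 * f x 1 0)).
  by apply: continuousM; apply: mx_entry_continuous.
by apply: continuousM; apply: mx_entry_continuous.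
Qed.

Lemma inv22_continuous (T : topologicalType) (f : T -> 'M[R]_2) t :
  \det (f t) != 0 -> {for t, continuous f} ->
  {for t, continuous (fun x => inv22 (f x))}.
Proof.
move=> f0 cf; apply: mx_continuous => i j.
have -> : (fun x => inv22 (f x) i j) =
    (fun x => (\det (f x))^-1 * adj22 (f x) i j).
  by apply/funext => x; rewrite mxE.
apply: continuousM.
  by apply: continuousV => //; exact: det_continuous.
apply: mx_entry_continuous; apply: mx_continuous.
apply: ord2_ind; apply: ord2_ind.
- rewrite (_ : (fun x => _) = (fun x => f x 1 1)); first exact: mx_entry_continuous.
  by apply/funext => x; rewrite mxE.
- rewrite (_ : (fun x => _) = (fun x => - f x 0 1)).
    by apply: (@continuousN _ R^o); exact: mx_entry_continuous.
  by apply/funext => x; rewrite mxE.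
- rewrite (_ : (fun x => _) = (fun x => - f x 1 0)).
    by apply: (@continuousN _ R^o); exact: mx_entry_continuous.
  by apply/funext => x; rewrite mxE.
- rewrite (_ : (fun x => _) = (fun x => f x 0 0)); first exact: mx_entry_continuous.
  by apply/funext => x; rewrite mxE.
Qed.

Lemma closure_map (T U : topologicalType) (B : set T) (C : set U) (f : T -> U) x :
  {for x, continuous f} -> (forall y, B y -> C (f y)) ->
  closure B x -> closure C (f x).
Proof.
move=> cf BC clB V /cf /clB [y [By Vy]]; exists (f y); split => //; exact: BC.
Qed.

Lemma GL2pM M N : @GL2p R M -> GL2p N -> GL2p (M *m N).
Proof. by rewrite /GL2p /= det_mulmx; exact: mulr_gt0. Qed.

Lemma GL2pV M : @GL2p R M -> GL2p (invmx M).
Proof. by rewrite /GL2p /= det_inv invr_gt0. Qed.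

Lemma GL2p_neq0 M : @GL2p R M -> \det M != 0.
Proof. by move=> /gt_eqF ->. Qed.

(** B is an abstract subgroup of GL2+; it need not be closed. *)
Record GL2p_subgroup B : Prop := {
  subgroup_GL2p : B `<=` @GL2p R;
  subgroup1 : B 1%:M;
  subgroupM : forall M N, B M -> B N -> B (M *m N);
  subgroupV : forall M, B M -> B (invmx M) }.

(** The closure of B in GL2+ is a closed subgroup containing S. *)
Lemma GL2p_subgroup_dense S B : topologically_generates_GL2p S ->
  GL2p_subgroup B -> S `<=` B -> @GL2p R `<=` closure B.
Proof.
move=> [SGL gen] [BGL B1 BM BV] SB.
suff <- : closure B `&` @GL2p R = @GL2p R by move=> M [].
have closureM M N : closure B M -> closure B N -> closure B (M *m N).
  move=> clM clN; rewrite ((closure_id (closure B)).1 (@closed_closure _ B)).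
  apply: (@closure_map _ _ B (closure B) (fun Z => Z *m N) M) clM.
    by apply: mulmx_continuous => //; exact: cst_continuous.
  move=> M' BM'; apply: (@closure_map _ _ B B (mulmx M') N) clN => [|N' BN'].
    by apply: mulmx_continuous => //; exact: cst_continuous.
  exact: BM.
apply: gen.
- by move=> M [].
- by split; [exact: subset_closure|exact: BGL].
- by move=> M N [clM GM] [clN GN]; split; [exact: closureM|exact: GL2pM].
- move=> M [clM GM]; split; last exact: GL2pV.
  rewrite -(inv22E (GL2p_neq0 GM)).
  apply: (@closure_map _ _ B B inv22 M) clM.
    by apply: (@inv22_continuous _ id) => //; exact: GL2p_neq0.
  by move=> N BN; rewrite inv22E; [exact: BV|exact/GL2p_neq0/BGL].
- move=> M [clM GM]; split => //.
  rewrite ((closure_id (closure B)).1 (@closed_closure _ B)).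
  by move: clM; apply: closureS => N [].
- by move=> M SM; split; [exact/subset_closure/SB|exact: SGL].
Qed.

(** The elements of B that can be joined to 1 by a continuous curve in B. The
    curve is parametrized by all of R, and is at 1 at time 0 and at g at time 1. *)
Definition arc_component B : set 'M[R]_2 :=
  [set g | exists c : R -> 'M[R]_2,
    [/\ continuous c, c 0 = 1%:M, c 1 = g & forall s, B (c s)]].

Lemma arc_component_sub B : arc_component B `<=` B.
Proof. by move=> g [c [_ _ <- Bc]]. Qed.

Lemma arc_component_subgroup B : GL2p_subgroup B -> GL2p_subgroup (arc_component B).
Proof.
move=> [BGL B1 BM BV]; split.
- by move=> M /arc_component_sub /BGL.
- by exists (fun=> 1%:M); split => //; exact: cst_continuous.
- move=> M N [c [cc c0 c1 Bc]] [d [cd d0 d1 Bd]].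
  exists (fun s => c s *m d s); split; rewrite ?c0 ?d0 ?mulmx1 ?c1 ?d1 // => s.
    by apply: mulmx_continuous; [exact: cc|exact: cd].
  exact: BM.
- move=> M [c [cc c0 c1 Bc]].
  have cE s : inv22 (c s) = invmx (c s) by apply/inv22E/GL2p_neq0/BGL.
  exists (fun s => inv22 (c s)); split; rewrite ?cE ?c0 ?c1 ?invmx1 // => s.
    by apply: inv22_continuous; [exact/GL2p_neq0/BGL|exact: cc].
  by rewrite cE; exact: BV.
Qed.

End Matrices22.

(** * Shears, and subgroups containing a section of GL2+ over the punctured plane *)

Section Shears.
Variable R : realType.
Implicit Types (b d : R) (g : 'M[R]_2) (B : set 'M[R]_2).

(** The matrices fixing the first basis vector; those with d > 0 form its
    stabilizer in GL2+, isomorphic to the group of increasing affine maps of R. *)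
Definition shear b d : 'M[R]_2 := mx22 1 b 0 d.

Lemma shearE b d : [/\ shear b d 0 0 = 1, shear b d 0 1 = b,
  shear b d 1 0 = 0 & shear b d 1 1 = d].
Proof. exact: mx22E. Qed.

Lemma shear_entry_eq b d b' d' : b = b' -> d = d' -> shear b d = shear b' d'.
Proof. by move=> -> ->. Qed.

Lemma shearM b d b' d' : shear b d *m shear b' d' = shear (b' + b * d') (d * d').
Proof.
have [h1 h2 h3 h4] := shearE b d; have [k1 k2 k3 k4] := shearE b' d'.
have [l1 l2 l3 l4] := shearE (b' + b * d') (d * d').
by apply: mx22P; rewrite mulmx_22 ?(h1, h2, h3, h4, k1, k2, k3, k4, l1, l2, l3,
  l4); ring.
Qed.

Lemma shear10 : shear 0 1 = 1%:M.
Proof.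
have [h1 h2 h3 h4] := shearE 0 1.
by apply: mx22P; rewrite ?(h1, h2, h3, h4) mxE.
Qed.

Lemma det_shear b d : \det (shear b d) = d.
Proof.
by have [h1 h2 h3 h4] := shearE b d; rewrite det_22 h1 h2 h3 h4; ring.
Qed.

Lemma shearV b d : d != 0 -> invmx (shear b d) = shear (- b / d) d^-1.
Proof.
move=> d0; have u : shear b d \in unitmx by rewrite det_unitmx ?det_shear.
rewrite -[RHS](mulKmx u) shearM -[LHS]mulmx1 -shear10; congr (_ *m _).
by apply: shear_entry_eq; field.
Qed.

Lemma mulmx_e1 m (g : 'M[R]_(m, 2)) i : (g *m e1) i 0 = g i 0.
Proof. by rewrite mulmx_22 /e1 !mxE /=; ring. Qed.

Lemma shearP g : g *m e1 = e1 -> g = shear (g 0 1) (g 1 1).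
Proof.
move=> /matrixP ge; have [h1 h2 h3 h4] := shearE (g 0 1) (g 1 1).
have := ge 0 0; have := ge 1 0; rewrite !mulmx_e1 /e1 !mxE /= => g1 g0.
by apply: mx22P; rewrite ?(h1, h2, h3, h4) ?g0 ?g1.
Qed.

(** A subgroup of GL2+ that contains two curves of shears, both starting at 1 and
    with noncommuting ends, contains all shears. The commutators of p(s) with
    q(1) are translations and give all shears with d = 1; the determinants along
    p or along q then give all d > 0. *)
Lemma all_shears B (p q : R -> 'M[R]_2) : GL2p_subgroup B ->
  continuous p -> continuous q -> p 0 = 1%:M -> q 0 = 1%:M ->
  (forall s, B (p s) /\ p s *m e1 = e1) -> (forall s, B (q s) /\ q s *m e1 = e1) ->
  p 1 *m q 1 != q 1 *m p 1 ->
  forall b d, 0 < d -> B (shear b d).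
Proof.
move=> [BGL B1 BM BV] cp cq p0 q0 Bp Bq pq.
have sh r : (forall s, B (r s) /\ r s *m e1 = e1) ->
    forall s, r s = shear (r s 0 1) (r s 1 1) /\ 0 < r s 1 1.
  move=> Br s; have [Brs /shearP rE] := Br s; split=> //.
  by move: (BGL _ Brs); rewrite /GL2p /= {1}rE det_shear.
have shp := sh _ _ Bp; have shq := sh _ _ Bq.
have transl b : B (shear b 1).
  (* the commutator of p(s) and q(1) is the shear with d = 1 and b = f(s) *)
  pose num s := p s 0 1 * (q 1 1 1 - 1) - q 1 0 1 * (p s 1 1 - 1).
  pose f s := num s / (p s 1 1 * q 1 1 1).
  have commE s : p s *m q 1 *m invmx (q 1 *m p s) = shear (f s) 1.
    have [pE pd] := shp s; have [qE qd] := shq 1.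
    have u : q 1 *m p s \in unitmx.
      apply/det_unitmx/GL2p_neq0/GL2pM; apply: BGL; first by have [] := Bq 1.
      by have [] := Bp s.
    rewrite -[RHS](mulmxK u); congr (_ *m _).
    rewrite {1 2}pE {1 2}qE !shearM; apply: shear_entry_eq;
      last by rewrite mul1r mulrC.
    by rewrite /f /num; field; rewrite !gt_eqF.
  apply: (@subgroup_path R [set b | B (shear b 1)] f) => /=.
  - move=> x y Bx By; rewrite (_ : shear _ _ = shear y 1 *m shear x 1);
      first exact: BM.
    by rewrite shearM; apply: shear_entry_eq; ring.
  - move=> x Bx; rewrite (_ : shear _ _ = invmx (shear x 1)); first exact: BV.
    by rewrite shearV ?oner_eq0 //; apply: shear_entry_eq; rewrite ?divr1 ?invr1.
  - move=> s; have [_ pd] := shp s; have [_ qd] := shq 1.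
    apply: continuousM; last apply: continuousV.
    + apply: (@continuousB _ R^o _ (fun s => p s 0 1 * (q 1 1 1 - 1))
        (fun s => q 1 0 1 * (p s 1 1 - 1))).
        apply: continuousM; last exact: cst_continuous.
        by apply: mx_entry_continuous; exact: cp.
      apply: continuousM; first exact: cst_continuous.
      apply: (@continuousB _ R^o _ (fun s => p s 1 1)); last exact: cst_continuous.
      by apply: mx_entry_continuous; exact: cp.
    + by rewrite mulf_neq0 // gt_eqF.
    + apply: continuousM; last exact: cst_continuous.
      by apply: mx_entry_continuous; exact: cp.
  - by rewrite /f /num p0 !mxE /=; ring.
  - apply: contra pq => /eqP f1; have := commE 1.
    rewrite f1 shear10 => /(congr1 (fun Z => Z *m (q 1 *m p 1))).
    rewrite mulmxKV ?mul1mx; first by move=> ->.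
    apply/det_unitmx/GL2p_neq0/GL2pM; apply: BGL; first by have [] := Bq 1.
    by have [] := Bp 1.
  - move=> s; rewrite -commE; apply: (BM); last apply: (BV); apply: (BM);
      by [have [] := Bp s|have [] := Bq 1].
(* the ends do not commute, so they are not both of determinant 1 *)
have [r [cr r0 Br r1]] : exists r : R -> 'M[R]_2, [/\ continuous r, r 0 = 1%:M,
    forall s, B (r s) /\ r s *m e1 = e1 & r 1 1 1 != 1].
  have [pd|pd] := eqVneq (p 1 1 1) 1; last by exists p.
  have [qd|qd] := eqVneq (q 1 1 1) 1; last by exists q.
  move: pq; rewrite (shp 1).1 (shq 1).1 pd qd !shearM.
  by rewrite (_ : shear _ _ = shear (p 1 0 1 + q 1 0 1 * 1) (1 * 1)) ?eqxx //;
    apply: shear_entry_eq; ring.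
have shr := sh _ _ Br.
have dil x : exists b, B (shear b (expR x)).
  apply: (@subgroup_path R [set x | exists b,
    B (shear b (expR x))] (fun s => ln (r s 1 1))) => /=.
  - move=> y z [b By] [b' Bz]; exists (b' + b * expR z).
    by rewrite expRD -shearM; exact: BM.
  - move=> y [b By]; exists (- b / expR y).
    by rewrite expRN -shearV ?gt_eqF ?expR_gt0 //; exact: BV.
  - move=> s; apply: continuous_comp; last by apply: continuous_ln; have [] := shr s.
    by apply: mx_entry_continuous; exact: cr.
  - by rewrite r0 !mxE /= ln1.
  - by rewrite ln_eq0 //; have [] := shr 1.
  - move=> s; have [rE rd] := shr s; exists (r s 0 1).
    by rewrite lnK // -rE; have [] := Br s.
move=> b d d0; have [b' Bb'] := dil (ln d).
rewrite lnK // in Bb'.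
rewrite (_ : shear b d = shear ((b - b') / d) 1 *m shear b' d).
  exact: BM.
by rewrite shearM; apply: shear_entry_eq; [field; rewrite gt_eqF|ring].
Qed.

End Shears.

(** [tr] is a continuous section, normalized at e1, of the action map g |-> g e1
    from GL2+ to the punctured plane, and its values topologically generate
    GL2+. For a quasifield, [tr x] is the left translation by x. *)
Section SharpSection.
Variables (R : realType) (tr : 'cV[R]_2 -> 'M[R]_2).
Hypothesis tr_cont : continuous tr.
Hypothesis tr_e1 : tr e1 = 1%:M.
Hypothesis trE : forall x : 'cV[R]_2, x != 0 -> tr x *m e1 = x.
Hypothesis polar : forall x : 'cV[R]_2, x != 0 -> exists r t : R,
  0 < r /\ x = r *: (Defs.rot t *m e1).
Hypothesis gen : topologically_generates_GL2p [set tr x | x in Qstar].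

Lemma rot_e1_continuous (r t : R) :
  continuous (fun s : R => expR (s * r) *: (Defs.rot (s * t) *m e1)).
Proof.
have mulc k : continuous (fun s : R => s * k).
  by move=> s; apply: continuousM; [exact: id|exact: cst_continuous].
move=> s; apply: mx_continuous => i j; rewrite ord1.
rewrite (_ : (fun x => _) = (fun x => expR (x * r) * Defs.rot (x * t) i 0));
  last first.
  by apply/funext => x; rewrite mxE mulmx_e1.
apply: continuousM.
  by apply: (@continuous_comp R R R (fun s => s * r) expR s);
    [exact: mulc|exact: continuous_expR].
move: i; apply: ord2_ind.
- rewrite (_ : (fun x => _) = cos \o (fun x => x * t)).
    by apply: continuous_comp; [exact: mulc|exact: continuous_cos].
  by apply/funext => x; rewrite mxE.
- rewrite (_ : (fun x => _) = (fun x => - (sin \o (fun x => x * t)) x)).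
    apply: (@continuousN _ R^o).
    by apply: continuous_comp; [exact: mulc|exact: continuous_sin].
  by apply/funext => x; rewrite mxE.
Qed.

Lemma rot_e1_neq0 (r t : R) : 0 < r -> r *: (Defs.rot t *m e1) != 0 :> 'cV[R]_2.
Proof.
move=> r0; rewrite scaler_eq0 gt_eqF //=; apply/eqP => /matrixP h.
have := h 0 0; have := h 1 0; rewrite !mulmx_e1 !mxE /= => /eqP.
rewrite oppr_eq0 => /eqP s0 c0; have := cos2Dsin2 t.
by rewrite s0 c0 expr0n /= addr0 => /eqP; rewrite eq_sym oner_eq0.
Qed.

Lemma e1_neq0 : e1 != 0 :> 'cV[R]_2.
Proof.
by apply/eqP => /matrixP /(_ 0 0); rewrite !mxE /= => /eqP; rewrite oner_eq0.
Qed.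

Lemma GL2p_e1 (g : 'M[R]_2) : GL2p g -> g *m e1 != 0.
Proof.
move=> /GL2p_neq0 /det_unitmx u; apply: contra e1_neq0 => /eqP h.
by rewrite -[e1](mulKmx u) h mulmx0.
Qed.

Lemma rot0 : Defs.rot 0 = 1%:M :> 'M[R]_2.
Proof. by rewrite /Defs.rot cos0 sin0 oppr0; exact: shear10. Qed.

Lemma tr_GL2p x : x != 0 -> GL2p (tr x).
Proof. by move=> x0; apply: gen.1; exists x. Qed.

Lemma tr_arc_component (B : set 'M[R]_2) x : (forall x, x != 0 -> B (tr x)) ->
  x != 0 ->
  arc_component B (tr x).
Proof.
move=> Btr /polar [r [t [r0 xE]]].
exists (fun s => tr (expR (s * ln r) *: (Defs.rot (s * t) *m e1))); split.
- move=> s; apply: (continuous_comp (@rot_e1_continuous (ln r) t s)); exact: tr_cont.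
- by rewrite !mul0r expR0 scale1r rot0 mul1mx.
- by rewrite !mul1r lnK // -xE.
- by move=> s; apply/Btr/rot_e1_neq0/expR_gt0.
Qed.

(** The component of g in the stabilizer of e1, in the factorization of GL2+ as
    the image of [tr] times this stabilizer. *)
Definition stab_part (g : 'M[R]_2) := inv22 (tr (g *m e1)) *m g.

Lemma stab_partE g : GL2p g -> stab_part g = invmx (tr (g *m e1)) *m g.
Proof. by move=> Gg; rewrite /stab_part inv22E //;
  apply/GL2p_neq0/tr_GL2p/GL2p_e1. Qed.

Lemma stab_part_e1 g : GL2p g -> stab_part g *m e1 = e1.
Proof.
move=> Gg; rewrite stab_partE // -mulmxA.
move: (g *m e1) (GL2p_e1 Gg) => x x0; rewrite -{2}(trE x0) mulKmx //.
exact/det_unitmx/GL2p_neq0/tr_GL2p.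
Qed.

Lemma stab_part_continuous g : GL2p g -> {for g, continuous stab_part}.
Proof.
move=> Gg; rewrite /stab_part.
apply: (@mulmx_continuous R 'M[R]_2 2 2 (fun g => inv22 (tr (g *m e1))) id g);
  last exact: id.
apply: (@inv22_continuous R 'M[R]_2 (fun g => tr (g *m e1)) g).
  exact/GL2p_neq0/tr_GL2p/GL2p_e1.
apply: (@continuous_comp 'M[R]_2 'cV[R]_2 'M[R]_2 (fun g => g *m e1) tr g);
  last exact: tr_cont.
by apply: mulmx_continuous; [exact: id|exact: cst_continuous].
Qed.

Lemma stab_part_id g : g *m e1 = e1 -> stab_part g = g.
Proof.
by move=> ge; rewrite /stab_part ge tr_e1 inv22E ?invmx1 ?mul1mx // det1 oner_eq0.
Qed.

(** An abstract subgroup of GL2+ containing the section is GL2+: no closedness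
    is required. *)
Lemma GL2p_subgroup_full B : GL2p_subgroup B -> (forall x, x != 0 -> B (tr x)) ->
  @GL2p R `<=` B.
Proof.
move=> gB Btr; have [BGL B1 BM BV] := gB.
pose C := arc_component B.
have gC : GL2p_subgroup C := arc_component_subgroup gB.
have dense : @GL2p R `<=` closure C.
  apply: (GL2p_subgroup_dense gen gC) => _ [x x0 <-]; exact: tr_arc_component.
have Bstab g : B g -> B (stab_part g).
  move=> Bg; rewrite stab_partE; last exact: BGL.
  by apply: BM => //; apply/BV/Btr/GL2p_e1/BGL.
have arc g : C g -> exists p : R -> 'M[R]_2, [/\ continuous p, p 0 = 1%:M,
    forall s, B (p s) /\ p s *m e1 = e1 & p 1 = stab_part g].
  move=> [c [cc c0 c1 Bc]]; exists (stab_part \o c); split => [s| |s|] /=.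
  - by apply: continuous_comp; [exact: cc|exact/stab_part_continuous/BGL].
  - by rewrite c0 stab_part_id // mul1mx.
  - by split; [exact: Bstab|exact/stab_part_e1/BGL].
  - by rewrite c1.
(* for two shears, F vanishes exactly when they commute *)
pose F (g h : 'M[R]_2) := g 0 1 * (h 1 1 - 1) - h 0 1 * (g 1 1 - 1).
pose s1 : 'M[R]_2 := shear 1 1; pose s2 : 'M[R]_2 := shear 0 2.
have sheare b d : shear b d *m e1 = e1 :> 'cV[R]_2.
  by apply: cV2P; rewrite mulmx_e1 /e1 !mxE.
have Fc1 h g : GL2p g -> {for g, continuous (fun g => F h (stab_part g))}.
  move=> /stab_part_continuous cg.
  apply: (@continuousB _ R^o _ (fun g => h 0 1 * (stab_part g 1 1 - 1))
    (fun g => stab_part g 0 1 * (h 1 1 - 1))).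
    apply: continuousM; first exact: cst_continuous.
    apply: (@continuousB _ R^o _ (fun g => stab_part g 1 1));
      last exact: cst_continuous.
    exact: mx_entry_continuous.
  apply: continuousM; last exact: cst_continuous.
  exact: mx_entry_continuous.
have FN g h : F g h = - F h g by rewrite /F; ring.
have near_pos (h s : 'M[R]_2) : GL2p s -> F h (stab_part s) != 0 ->
    exists2 g, C g & F h (stab_part g) != 0.
  move=> Gs Fs.
  have : nbhs s [set g | F h (stab_part g) != 0].
    exact: (cvgr_neq0 _ (Fc1 h s Gs) Fs).
  by move/(dense _ Gs) => [g [Cg hg]]; exists g.
have G1 : GL2p s1 by rewrite /GL2p /= det_shear.
have G2 : GL2p s2 by rewrite /GL2p /= det_shear.
have [g2 Cg2 F2] : exists2 g, C g & F s1 (stab_part g) != 0.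
  apply: (near_pos s1 s2 G2); rewrite stab_part_id ?sheare //.
  by rewrite /F !mxE /= gt_eqF //; lra.
have [g1 Cg1 F1] : exists2 g, C g & F (stab_part g2) (stab_part g) != 0.
  by apply: (near_pos (stab_part g2) s1 G1);
    rewrite [stab_part s1]stab_part_id ?sheare // FN oppr_eq0.
have [p [cp p0 Bp p1]] := arc _ Cg1; have [q [cq q0 Bq q1]] := arc _ Cg2.
have Bsh := all_shears gB cq cp q0 p0 Bq Bp.
move=> g Gg; rewrite -[g](mulKVmx (det_unitmx (GL2p_neq0 (tr_GL2p (GL2p_e1 Gg)))))
  -stab_partE //.
apply: BM; first exact/Btr/GL2p_e1.
rewrite (shearP (stab_part_e1 Gg)); apply: Bsh.
- apply: contra F1 => /eqP; rewrite p1 q1.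
  rewrite (shearP (stab_part_e1 (gC.(subgroup_GL2p) Cg1))).
  rewrite (shearP (stab_part_e1 (gC.(subgroup_GL2p) Cg2))).
  rewrite !shearM => /matrixP /(_ 0 1).
  rewrite /F !mxE /= => h; apply/eqP; lra.
- move: (stab_part_e1 Gg) => /shearP sE.
  have := GL2pM (GL2pV (tr_GL2p (GL2p_e1 Gg))) Gg.
  by rewrite -stab_partE // /GL2p /= {1}sE det_shear.
Qed.

End SharpSection.

(** * Cosets of a normal subloop *)

Section NormalSubloop.
Variables (T : Type) (L : set T) (mul : T -> T -> T) (e : T) (N : set T).
Hypothesis loopL : is_loop L mul e.
Hypothesis normN : normal_subloop L mul e N.

(** z lies in the coset y N. *)
Definition same_coset (y z : T) := exists2 n, N n & mul y n = z.

(** x (y N) = (x y) N *)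
Lemma normal_mul_coset x y : L x -> L y ->
  [set mul x (mul y n) | n in N] = [set mul (mul x y) n | n in N].
Proof.
have [_ comm assl assr] := normN; move=> Lx Ly.
have -> : [set mul x (mul y n) | n in N] = [set mul x (mul n y) | n in N].
  have img (A : T -> T) : [set mul x (A n) | n in N] = mul x @` [set A n | n in N].
    by rewrite image_comp.
  by rewrite (img (mul y)) (img (mul^~ y)) comm.
rewrite -assl //.
have -> : [set mul (mul x n) y | n in N] = [set mul (mul n x) y | n in N].
  have img (A : T -> T) : [set mul (A n) y | n in N] = mul^~ y @` [set A n | n in N].
    by rewrite image_comp.
  by rewrite (img (mul x)) (img (mul^~ x)) comm.
by rewrite assr // comm //; exact: (loop_closed loopL).
Qed.

Lemma loop_mul_inj x y z : L x -> L y -> L z -> mul x y = mul x z -> y = z.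
Proof.
move=> Lx Ly Lz xyz.
have [w [_ uw]] := loop_ldiv loopL Lx (loop_closed loopL Lx Ly).
by rewrite -(uw y) // -(uw z).
Qed.

(** Left translations permute the cosets of N. *)
Lemma same_coset_mul x y z : L x -> L y -> L z ->
  same_coset y z <-> same_coset (mul x y) (mul x z).
Proof.
move=> Lx Ly Lz; have [[NL _] _ _ _] := normN.
have E := normal_mul_coset Lx Ly; split=> [[n Nn <-]|[n Nn h]].
  have : [set mul (mul x y) n | n in N] (mul x (mul y n)) by rewrite -E; exists n.
  by case=> m Nm; exists m.
have : [set mul x (mul y n) | n in N] (mul x z) by rewrite E; exists n.
move=> [m Nm h']; exists m => //; apply: (loop_mul_inj Lx) => //.
by apply: (loop_closed loopL) => //; exact: NL.
Qed.

Lemma same_coset_id z : L z -> same_coset e z <-> N z.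
Proof.
have [[NL _] _ _ _] := normN.
move=> Lz; split=> [[n Nn <-]|Nz]; first by rewrite (loop_mul1l loopL) //; exact: NL.
by exists z => //; exact: (loop_mul1l loopL).
Qed.

End NormalSubloop.

Section Quasifield.
Variables (R : realType) (mul : 'cV[R]_2 -> 'cV[R]_2 -> 'cV[R]_2).
Hypothesis Hqf : topological_quasifield mul.
Hypothesis Hlin : forall x, Qstar x -> linear (mul x).

Let loopQ : is_loop Qstar mul e1.
Proof. by have [[]] := Hqf. Qed.

(** The matrix of the left translation by x, whose columns are the products of x
    with the two basis vectors. *)
Definition trans x : 'M[R]_2 := \matrix_(i, j) mul x (delta_mx j 0) i 0.

Lemma transE x y : x != 0 -> mul x y = trans x *m y.
Proof.
move=> x0; have lx := Hlin x0.
have yE : y = y 0 0 *: delta_mx 0 0 + (y 1 0 *: delta_mx 1 0 + 0).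
  by apply: cV2P; rewrite !mxE /=; ring.
rewrite {1}yE lx lx.
have -> : mul x 0 = 0.
  have := lx 1 0 0; rewrite !scale1r !addr0 => /eqP.
  by rewrite -subr_eq0 opprD addNKr oppr_eq0 => /eqP.
by apply: cV2P; rewrite !mulmx_22 !mxE; ring.
Qed.

Lemma trans_continuous : continuous trans.
Proof.
have [_ cm _] := Hqf.
move=> x; apply: mx_continuous => i j.
rewrite (_ : (fun x => _) = (fun x => mul x (delta_mx j 0) i 0)); last first.
  by apply/funext => y; rewrite mxE.
have : mul y (delta_mx j 0) @[y --> x] --> mul x (delta_mx j 0).
  apply: (@continuous2_cvg 'cV[R]_2 'cV[R]_2 'cV[R]_2 'cV[R]_2 (nbhs x)
    _ id (fun=> delta_mx j 0) mul x).
  - exact: (cm (x, delta_mx j 0)).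
  - exact: cvg_id.
  - exact: cvg_cst.
exact: (@mx_entry_continuous R 'cV[R]_2).
Qed.

Lemma mul_e1 x : x != 0 -> mul x e1 = x.
Proof. by move=> x0; exact: (loop_mul1r loopQ). Qed.

Lemma trans_mul_e1 x : x != 0 -> trans x *m e1 = x.
Proof. by move=> x0; rewrite -transE // mul_e1. Qed.

Lemma mx22_ext (A B : 'M[R]_2) : (forall y : 'cV[R]_2, A *m y = B *m y) -> A = B.
Proof.
move=> AB; apply/matrixP => i j.
have /matrixP/(_ i 0) := AB (delta_mx j 0).
rewrite !mulmx_22 !mxE; move: j; apply: ord2_ind => /=;
  by rewrite !mulr1 !mulr0 ?addr0 ?add0r.
Qed.

Lemma trans_e1 : trans e1 = 1%:M.
Proof.
apply: mx22_ext => y; rewrite -transE ?e1_neq0 // mul1mx.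
have [->|y0] := eqVneq y 0; last exact: (loop_mul1l loopQ).
by rewrite transE ?e1_neq0 // mulmx0.
Qed.

Lemma left_translationsE (A : set 'cV[R]_2) : A `<=` Qstar ->
  left_translations mul A = [set trans x | x in A].
Proof.
move=> AQ; apply/seteqP; split => [M [x Ax xM]|_ [x Ax <-]].
  by exists x => //; apply: mx22_ext => y; rewrite -transE ?xM //; exact: AQ.
by exists x => // y; apply: transE; exact: AQ.
Qed.

Lemma mulZr x (k : R) y : x != 0 -> mul x (k *: y) = k *: mul x y.
Proof. by move=> x0; rewrite !transE // -scalemxAr. Qed.

Section Coordinates.
Variables a b : R -> R -> R.
Hypothesis Hab : section_functions a b.
Hypothesis Hsec : left_translations mul Qstar = section_matrices a b.

Lemma trans_section x : x != 0 -> exists u t, [/\ 0 < u, 0 <= t < 2 * pi &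
  trans x = u *: (Defs.rot t *m mx22 (a u t) (b u t) 0 (a u t)^-1)].
Proof.
move=> x0; suff : section_matrices a b (trans x) by [].
by rewrite -Hsec left_translationsE //; exists x.
Qed.

Lemma trans_polar x : x != 0 -> exists r t : R, 0 < r /\ x = r *: (Defs.rot t *m e1).
Proof.
move=> x0; have [u [t [u0 _ xE]]] := trans_section x0.
have [_ _ _ apos _] := Hab.
exists (u * a u t), t; split; first by rewrite mulr_gt0 // apos.
rewrite -[LHS]trans_mul_e1 // xE -scalemxAl -mulmxA -scalerA; congr (_ *: _).
by rewrite scalemxAr; congr (_ *m _); apply: cV2P; rewrite mulmx_e1 !mxE /=; ring.
Qed.

End Coordinates.

Section Normal.
Hypothesis Hgen : topologically_generates_GL2p (left_translations mul Qstar).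
Hypothesis polar : forall x : 'cV[R]_2, x != 0 -> exists r t : R,
  0 < r /\ x = r *: (Defs.rot t *m e1).
Variable N : set 'cV[R]_2.
Hypothesis normN : normal_subloop Qstar mul e1 N.

Let gen : topologically_generates_GL2p [set trans x | x in Qstar].
Proof. by rewrite -left_translationsE. Qed.

Let NQ : N `<=` Qstar.
Proof. by have [[]] := normN. Qed.

Let loopN : is_loop N mul e1.
Proof. by have [[]] := normN. Qed.

(** All of GL2+, and not only the left translations, permutes the cosets of N. *)
Lemma GL2p_coset g y z : GL2p g -> y != 0 -> z != 0 ->
  same_coset mul N y z <-> same_coset mul N (g *m y) (g *m z).
Proof.
pose B : set 'M[R]_2 := [set g | GL2p g /\ forall y z, y != 0 -> z != 0 ->
  (same_coset mul N y z <-> same_coset mul N (g *m y) (g *m z))].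
have GL0 h x : GL2p h -> x != 0 -> h *m x != 0 :> 'cV[R]_2.
  move=> /GL2p_neq0 /det_unitmx u; apply: contra => /eqP hx.
  by rewrite -[x](mulKmx u) hx mulmx0.
suff GB : @GL2p R `<=` B by move=> Gg; apply: (GB g Gg).2.
apply: (@GL2p_subgroup_full _ trans); rewrite //.
- exact: trans_continuous.
- exact: trans_e1.
- exact: trans_mul_e1.
- split.
  + by move=> h [].
  + by split; [rewrite /GL2p /= det1|move=> u v u0 v0; rewrite !mul1mx].
  + move=> h k [Gh Bh] [Gk Bk]; split; first exact: GL2pM.
    move=> u v u0 v0; rewrite -!mulmxA (Bk u v) //; apply: Bh; exact: GL0.
  + move=> h [Gh Bh]; split; first exact: GL2pV.
    move=> u v u0 v0; rewrite (Bh (invmx h *m u)) ?mulKVmx //;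
      try (exact/det_unitmx/GL2p_neq0).
      by apply: GL0 => //; exact: GL2pV.
    by apply: GL0 => //; exact: GL2pV.
- move=> x x0; split; first by apply: gen.1; exists x.
  by move=> u v u0 v0; rewrite -!transE //; exact: (same_coset_mul loopQ normN).
Qed.

(** A matrix that maps e1 into N maps the coset N = e1 N to itself. *)
Lemma GL2p_normal g z : GL2p g -> N (g *m e1) -> N z <-> N (g *m z).
Proof.
move=> Gg Ng.
have /det_unitmx u := GL2p_neq0 Gg.
have [->|z0] := eqVneq z 0; first by rewrite mulmx0.
have gz0 : g *m z != 0.
  by apply: contra z0 => /eqP gz; rewrite -[z](mulKmx u) gz mulmx0.
rewrite -(same_coset_id loopQ normN z0) (GL2p_coset Gg (e1_neq0 R) z0).
split=> [[n Nn <-]|Ngz]; first exact: (loop_closed loopN).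
by have [w [[Nw wE] _]] := loop_ldiv loopN Ng Ngz; exists w.
Qed.

(** A point p of N off the axis is moved by shears to every point on its side of
    the axis, and multiples J of a quarter turn map N to itself. *)
Lemma normal_proper_axis : N <> Qstar -> forall x, N x -> x 1 0 = 0.
Proof.
move=> NneqQ p Np; apply: contrapT => /eqP p1; apply: NneqQ.
apply/seteqP; split => // w w0.
(* N contains the open half-plane of p *)
have half (q : 'cV[R]_2) : 0 < q 1 0 * p 1 0 -> N q.
  move=> qp.
  have d0 : 0 < q 1 0 / p 1 0.
    rewrite (_ : _ / _ = q 1 0 * p 1 0 / (p 1 0 ^+ 2)); last by field.
    by rewrite divr_gt0 // lt0r sqrf_eq0 p1 sqr_ge0.
  pose g : 'M[R]_2 := shear ((q 0 0 - p 0 0) / p 1 0) (q 1 0 / p 1 0).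
  have Gg : GL2p g by rewrite /GL2p /= det_shear.
  have ge : g *m e1 = e1 by apply: cV2P; rewrite mulmx_e1 /e1 !mxE.
  rewrite (_ : q = g *m p).
    have Ng : N (g *m e1) by rewrite ge; exact: (loop_id loopN).
    exact/(GL2p_normal p Gg Ng).
  by apply: cV2P; rewrite mulmx_22 !mxE /=; field.
pose s := p 1 0.
pose J : 'M[R]_2 := mx22 0 (- s) s 0.
have GJ : GL2p J.
  by rewrite /GL2p /= det_22 !mxE /= mulr0 mulNr sub0r opprK -expr2 lt0r sqrf_eq0 p1 sqr_ge0.
have Je : N (J *m e1).
  by apply: half; rewrite mulmx_e1 mxE /= -expr2 lt0r sqrf_eq0 p1 sqr_ge0.
have NJ z : N z <-> N (J *m z) := GL2p_normal z GJ Je.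
have J1 (z : 'cV[R]_2) : (J *m z) 1 0 = s * z 0 0 by rewrite mulmx_22 !mxE /=; ring.
have J0 (z : 'cV[R]_2) : (J *m z) 0 0 = - s * z 1 0 by rewrite mulmx_22 !mxE /=; ring.
have s2 : 0 < s ^+ 2 by rewrite lt0r sqrf_eq0 p1 sqr_ge0.
have [h|h|h] := ltgtP (w 1 0 * p 1 0) 0; last first.
- have w1 : w 1 0 = 0 by move/eqP: h; rewrite mulf_eq0 (negPf p1) orbF => /eqP.
  have w00 : w 0 0 != 0.
    by apply: contra w0 => /eqP w00; apply/eqP; apply: cV2P; rewrite ?w1 ?w00 mxE.
  have [w0p|w0n] := ltP 0 (w 0 0).
    by apply/NJ/half; rewrite J1 -/s mulrAC -expr2 mulr_gt0.
  apply/NJ/NJ/NJ/half; rewrite J1 J0 J1 -/s.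
  rewrite (_ : _ * _ = s ^+ 2 * s ^+ 2 * - w 0 0); last by ring.
  have : 0 < - w 0 0 by rewrite oppr_gt0 lt_neqAle w00.
  by apply: mulr_gt0; exact: mulr_gt0.
- exact: half.
- apply/NJ/NJ/half; rewrite J1 J0 -/s.
  rewrite (_ : _ * _ = s ^+ 2 * - (w 1 0 * p 1 0)); last by rewrite /s; ring.
  by apply: mulr_gt0; rewrite ?oppr_gt0.
Qed.

End Normal.
End Quasifield.

(** * Homogeneity of the multiplication *)

Section ZeroDimensional.
Variable R : realType.

(** A multiplicative subgroup of the nonzero reals that misses some positive
    number misses a point of every interval: otherwise it contains a
    neighbourhood of 1, hence all positive numbers. *)
Lemma mul_subgroup_gap (A : set R) : ~ A 0 ->
  (forall r s, A r -> A s -> A (r * s)) -> (forall r s, A r -> A s -> A (s / r)) ->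
  forall r0, 0 < r0 -> ~ A r0 ->
  forall l h, l < h -> exists2 c, l < c < h & ~ A c.
Proof.
move=> A0 AM AV r0 r0p Ar0 l h lh; apply: contrapT => nogap.
have Alh c : l < c < h -> A c.
  by move=> lch; apply: contrapT => Ac; apply: nogap; exists c.
apply: Ar0; rewrite -(lnK r0p).
apply: (@subgroup_nbhs0 R [set x | A (expR x)]) => /=.
  by move=> x y; rewrite expRD; exact: AM.
pose c := (l + h) / 2.
have lch : l < c < h by apply/andP; split; rewrite /c; lra.
have Ac := Alh _ lch.
have c0 : c != 0 by apply/eqP => c0; rewrite c0 in Ac.
have cont : {for (0 : R), continuous (fun x : R => c * expR x)}.
  by apply: continuousM; [exact: cst_continuous|exact: continuous_expR].
have : \forall y \near c * expR (0 : R), l < y < h.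
  rewrite expR0 mulr1; have /andP[lc ch] := lch.
  by near=> y; apply/andP; split; near: y; [exact: lt_nbhsr|exact: lt_nbhsl].
move/cont; apply: (@filterS _ (nbhs (0 : R)) (nbhs_filter _)) => x /= /Alh Acx.
by rewrite -[expR x](mulKf c0) mulrC; exact: AV.
Unshelve. all: by end_near. Qed.

(** A subset of the axis that misses a point of every interval is
    zero-dimensional: strips bounded by missing points have empty boundary in
    it. *)
Lemma ind_lt1_axis (N : set 'cV[R]_2) : (forall x, N x -> x 1 0 = 0) ->
  (forall l h : R, l < h -> exists2 c, l < c < h & ~ N (c *: e1)) -> ind_lt 1 N.
Proof.
move=> Nax gap x U Nx oU Ux.
have axisE v : N v -> v = v 0 0 *: e1.
  by move=> Nv; apply: cV2P; rewrite !mxE /= ?mulr1 ?mulr0 ?(Nax _ Nv).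
have cont : {for x 0 0, continuous (fun r : R => r *: e1 : 'cV[R]_2)}.
  apply: mx_continuous => i j.
  rewrite (_ : (fun r => _) = (fun r => r * e1 i j)); last first.
    by apply/funext => r; rewrite !mxE.
  by apply: continuousM; [exact: id|exact: cst_continuous].
have : nbhs (x 0 0 *: e1) U by rewrite -axisE //; exact: open_nbhs_nbhs.
move/cont => /nbhs_ballP [e /= e0 eU].
have [l /andP[le lx] Nl] := gap (x 0 0 - e) (x 0 0) ltac:(lra).
have [h /andP[hx he] Nh] := gap (x 0 0) (x 0 0 + e) ltac:(lra).
have openlt c : open [set v : 'cV[R]_2 | v 0 0 < c].
  by apply: (@open_comp _ _ (fun v : 'cV[R]_2 => v 0 0) [set y | y < c]) => [v _|];
    [exact: coord_continuous|exact: open_lt].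
have opengt c : open [set v : 'cV[R]_2 | c < v 0 0].
  by apply: (@open_comp _ _ (fun v : 'cV[R]_2 => v 0 0) [set y | c < y]) => [v _|];
    [exact: coord_continuous|exact: open_gt].
exists ([set v : 'cV[R]_2 | l < v 0 0] `&` [set v : 'cV[R]_2 | v 0 0 < h]); split.
- exact: openI.
- by split.
- move=> v [[/= lv vh] Nv]; rewrite (axisE _ Nv); apply: eU => /=.
  by rewrite /ball /= ltr_norml; apply/andP; split; lra.
- apply/seteqP; split => // v [[Nv clv] nVv]; apply: nVv.
  split => /=; rewrite ltNge; apply/negP; rewrite le_eqVlt => /orP[/eqP vE|vlt].
  + by apply: Nl; rewrite -vE -axisE.
  + have [w [[[/= lw _] _] /= wl]] := clv _ (open_nbhs_nbhs (conj (openlt l) vlt)).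
    by move: (lt_trans lw wl); rewrite ltxx.
  + by apply: Nh; rewrite vE -axisE.
  + have [w [[[/= _ wh] _] /= hw]] := clv _ (open_nbhs_nbhs (conj (opengt h) vlt)).
    by move: (lt_trans wh hw); rewrite ltxx.
Qed.

End ZeroDimensional.

Section Homogeneous.
Variables (R : realType) (mul : 'cV[R]_2 -> 'cV[R]_2 -> 'cV[R]_2).
Hypothesis Hqf : topological_quasifield mul.
Hypothesis Hlin : forall x, Qstar x -> linear (mul x).
Hypothesis Hgen : topologically_generates_GL2p (left_translations mul Qstar).

Let loopQ : is_loop Qstar mul e1.
Proof. by have [[]] := Hqf. Qed.

Variable N : set 'cV[R]_2.
Hypothesis normN : normal_subloop Qstar mul e1 N.
Hypothesis axisN : forall x, N x -> x 1 0 = 0.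

Let NQ : N `<=` Qstar.
Proof. by have [[]] := normN. Qed.

Let loopN : is_loop N mul e1.
Proof. by have [[]] := normN. Qed.

Let axisE v : N v -> v = v 0 0 *: e1.
Proof.
by move=> Nv; apply: cV2P; rewrite !mxE /= ?mulr1 ?mulr0 ?(axisN Nv).
Qed.

Lemma scale_e1_neq0 (r : R) : r != 0 -> r *: e1 != 0 :> 'cV[R]_2.
Proof. by move=> r0; rewrite scaler_eq0 negb_or r0 e1_neq0. Qed.

Lemma mul_scale_e1 x (r : R) : x != 0 -> mul x (r *: e1) = r *: x.
Proof. by move=> x0; rewrite (mulZr Hlin) // (mul_e1 Hqf). Qed.

Lemma normal_axis_positive : positive_dimension N -> forall r : R, 0 < r ->
  N (r *: e1).
Proof.
move=> dimN r r0; apply: contrapT => Nr; apply: dimN; apply: ind_lt1_axis => //.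
have A0 : ~ N (0 *: e1) by move/NQ; rewrite /Qstar /= scale0r eqxx.
have Aneq0 s : N (s *: e1) -> s != 0.
  by move=> Ns; apply/eqP => s0; rewrite s0 in Ns.
apply: (@mul_subgroup_gap R [set s | N (s *: e1)]) r0 Nr => //= s t Ns Nt.
  have := loop_closed loopN Nt Ns; rewrite mul_scale_e1 ?scale_e1_neq0 ?Aneq0 //.
  by rewrite scalerA.
have [z [[Nz zE] _]] := loop_ldiv loopN Ns Nt.
have s0 := Aneq0 _ Ns.
move: zE; rewrite (axisE Nz)
  mul_scale_e1 ?scale_e1_neq0 // scalerA => /matrixP/(_ 0 0).
by rewrite !mxE /= !mulr1 => <-; rewrite mulfK // -axisE.
Qed.

(** Since n = r e1 lies in N, (r x) y = (x n) y lies in x (N y) = x (y N), which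
    is contained in the line of x y. So the matrix D below has every vector as
    an eigenvector, and the eigenvalue at e1 is r. *)
Lemma trans_homogeneous (r : R) (x : 'cV[R]_2) : N (r *: e1) -> x != 0 ->
  trans mul (r *: x) = r *: trans mul x.
Proof.
move=> Nr x0.
have r0 : r != 0.
  by apply/eqP => rE; move/NQ: Nr; rewrite /Qstar /= rE scale0r eqxx.
have rx0 : r *: x != 0 by rewrite scaler_eq0 negb_or r0 x0.
have [_ comm assl _] := normN.
have prop (y : 'cV[R]_2) : y != 0 -> exists c, mul (r *: x) y = c *: mul x y.
  move=> y0; have : [set mul (mul x n) y | n in N] (mul (r *: x) y).
    by exists (r *: e1) => //; rewrite mul_scale_e1.
  rewrite assl // => -[n Nn <-].
  have : [set mul n y | n in N] (mul n y) by exists n.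
  rewrite -comm // => -[m Nm <-]; exists (m 0 0).
  by rewrite (axisE Nm) mul_scale_e1 // (mulZr Hlin) // !mxE /= mulr1.
have Gx : GL2p (trans mul x).
  by apply: Hgen.1; rewrite (left_translationsE Hlin) //; exists x.
have u := det_unitmx (GL2p_neq0 Gx).
pose D := invmx (trans mul x) *m trans mul (r *: x).
have Dprop (y : 'cV[R]_2) : y != 0 -> exists c, D *m y = c *: y.
  move=> y0; have [c cE] := prop y y0; exists c.
  by rewrite /D -mulmxA -(transE Hlin) // cE (transE Hlin) // -scalemxAr mulKmx.
have De1 : D *m e1 = r *: e1.
  rewrite /D -mulmxA (trans_mul_e1 Hqf Hlin)
    // -[in r *: x](trans_mul_e1 Hqf Hlin x0).
  by rewrite scalemxAr mulKmx.
suff DE : D = r%:M by rewrite -[LHS](mulKVmx u) -/D DE mul_mx_scalar.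
pose e2 : 'cV[R]_2 := delta_mx 1 0.
have nz (v : 'cV[R]_2) : v 1 0 = 1 -> v != 0.
  by move=> v1; apply/eqP => v0; move: v1; rewrite v0 mxE => /eqP;
    rewrite eq_sym oner_eq0.
have [c /matrixP cE] := Dprop e2 ltac:(by apply: nz; rewrite mxE).
have [d /matrixP dE] := Dprop (e1 + e2) ltac:(by apply: nz; rewrite !mxE /= add0r).
move/matrixP : De1 => De1; clear Dprop; clearbody D.
have := De1 0 0; have := De1 1 0; have := cE 0 0; have := cE 1 0; have := dE 0 0;
  have := dE 1 0.
rewrite /e2 !mulmx_22 !mxE /= => h1 h2 h3 h4 h5 h6.
by apply: mx22P; rewrite [RHS]mxE /=; lra.
Qed.

End Homogeneous.

(** * Polar coordinates and the loop of rays *)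

Section PolarCoordinates.
Variable R : realType.
Implicit Types t u : R.

(** On one period, the sign of the sine tells the two half-periods apart. *)
Lemma sin_sign t : 0 <= t < 2 * pi ->
  [\/ [/\ t <= pi & 0 <= sin t] | [/\ pi < t & sin t < 0]].
Proof.
move=> /andP[t0 t2]; have [tpi|tpi] := leP t pi; [left|right]; split => //.
  by apply: sin_ge0_pi; rewrite t0.
rewrite -[t](subrK pi) sinDpi oppr_lt0; apply: sin_gt0_pi.
by rewrite subr_gt0 tpi /=; lra.
Qed.

Lemma cos_sin_inj t t' : 0 <= t < 2 * pi -> 0 <= t' < 2 * pi ->
  cos t = cos t' -> sin t = sin t' -> t = t'.
Proof.
move=> ht ht' ct st; have := sin_sign ht; have := sin_sign ht'.
have := pi_gt0 R; move: ht ht' => /andP[t0 t2] /andP[t0' t2'] p0.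
move=> [[h1 h2]|[h1 h2]] [[k1 k2]|[k1 k2]]; try (exfalso; lra).
  by apply: cos_inj ct; rewrite in_itv /= ?t0 ?t0' ?h1 ?k1.
apply: (addIr (- pi)); apply: cos_inj; rewrite ?in_itv /=; try (apply/andP; split;
  lra).
by apply: oppr_inj; rewrite -!cosDpi !addrNK.
Qed.

Lemma sin_eq0_0pi t : 0 <= t < 2 * pi -> sin t = 0 -> t = 0 \/ t = pi.
Proof.
move=> ht st; case: (sin_sign ht) => -[h1 h2]; last by lra.
have [->|tpi] := eqVneq t pi; first by right.
have [->|t0] := eqVneq t 0; first by left.
have : 0 < sin t.
  apply: sin_gt0_pi; rewrite !lt_neqAle tpi h1 eq_sym t0 /=.
  by case/andP: ht => -> _.
by rewrite st ltxx.
Qed.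

(** Uniqueness of the coordinates of a matrix: the determinant is u^2, and the
    first column has norm u a and direction t. *)
Lemma section_matrix_inj u t u' t' a b a' b' : 0 < u -> 0 < u' ->
  0 <= t < 2 * pi -> 0 <= t' < 2 * pi -> 0 < a -> 0 < a' ->
  u *: (Defs.rot t *m mx22 a b 0 a^-1) = u' *: (Defs.rot t' *m mx22 a' b' 0 a'^-1) ->
  [/\ u = u', t = t', a = a' & b = b'].
Proof.
move=> u0 u0' ht ht' a0 a0' E.
have detE v s c d : c != 0 -> \det (v *: (Defs.rot s *m mx22 c d 0 c^-1)) = v ^+ 2.
  move=> c0; rewrite detZ det_mulmx !det_22 !mxE /= mulfV // mulr0 subr0 mulr1.
  by rewrite mulrN opprK -!expr2 cos2Dsin2 mulr1.
have uu : u = u'.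
  move/(congr1 determinant): E; rewrite !detE ?gt_eqF // => /eqP.
  by rewrite eqrXn2 ?ltW // => /eqP.
move: E; rewrite -uu => /(scalerI (negbT (gt_eqF u0))) /matrixP E.
have := E 0 0; have := E 1 0; have := E 0 1; have := E 1 1.
rewrite !mulmx_22 !mxE /= !mulr0 !addr0 => e11 e01 e10 e00.
have cs := cos2Dsin2 t; have cs' := cos2Dsin2 t'.
have aa : a = a'.
  apply/eqP; rewrite -(@eqrXn2 _ 2) ?ltW //; apply/eqP.
  transitivity ((cos t * a) ^+ 2 + (- sin t * a) ^+ 2).
    by rewrite -[LHS]mul1r -cs; ring.
  by rewrite e00 e10 -[RHS]mul1r -cs'; ring.
have an0 : a != 0 by rewrite gt_eqF.
rewrite -aa in e00 e10 e11 e01.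
have ct : cos t = cos t' by exact: (mulIf an0).
have st : sin t = sin t' by apply: oppr_inj; exact: (mulIf an0).
have tt := cos_sin_inj ht ht' ct st; split => //.
rewrite -ct -st in e11 e01.
have {}e01 := addIr _ e01; have {}e11 := addIr _ e11.
rewrite -[b]mul1r -[b']mul1r -cs.
transitivity (cos t * (cos t * b) - sin t * (- sin t * b)); first by ring.
by rewrite e01 e11; ring.
Qed.

End PolarCoordinates.

Section Rays.
Variable R : realType.
Implicit Types v w : 'cV[R]_2.

(** The point of the unit circle on the ray from the origin through v; it is 0 if
    v = 0. *)
Definition ray v : 'cV[R]_2 := (Num.sqrt (v 0 0 ^+ 2 + v 1 0 ^+ 2))^-1 *: v.

Lemma norm2_gt0 v : v != 0 -> 0 < v 0 0 ^+ 2 + v 1 0 ^+ 2.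
Proof.
move=> v0; rewrite lt0r addr_ge0 ?sqr_ge0 // andbT paddr_eq0 ?sqr_ge0 //.
rewrite !sqrf_eq0; apply: contra v0 => /andP[/eqP h0 /eqP h1].
by apply/eqP; apply: cV2P; rewrite ?h0 ?h1 mxE.
Qed.

Lemma ray_scale v : v != 0 -> exists2 s : R, 0 < s & ray v = s *: v.
Proof.
by move=> v0; exists (Num.sqrt (v 0 0 ^+ 2 + v 1 0 ^+ 2))^-1;
  rewrite // invr_gt0 sqrtr_gt0 norm2_gt0.
Qed.

Lemma circle_ray v : v != 0 -> circle (ray v).
Proof.
move=> v0; have n0 := norm2_gt0 v0; rewrite /circle /= !mxE !exprMn -mulrDr exprVn.
by rewrite sqr_sqrtr ?ltW // mulVf // gt_eqF.
Qed.

Lemma circle_neq0 v : circle v -> v != 0.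
Proof.
move=> cv; apply/eqP => v0; move: cv; rewrite v0 /circle /= !mxE expr0n /= addr0.
by move/eqP; rewrite eq_sym oner_eq0.
Qed.

Lemma ray_circle v : circle v -> ray v = v.
Proof. by move=> cv; rewrite /ray cv sqrtr1 invr1 scale1r. Qed.

Lemma rayZ (r : R) v : 0 < r -> ray (r *: v) = ray v.
Proof.
move=> r0; rewrite /ray !mxE !exprMn -mulrDr sqrtrM ?sqr_ge0 // sqrtr_sqr gtr0_norm //.
by rewrite invfM scalerA mulrAC mulVf ?mul1r // gt_eqF.
Qed.

Lemma ray_eq v w : v != 0 -> w != 0 -> ray v = ray w -> exists2 r : R,
  0 < r & v = r *: w.
Proof.
move=> /ray_scale [s s0 ->] /ray_scale [s' s0' ->] E.
exists (s^-1 * s'); first by rewrite mulr_gt0 ?invr_gt0.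
by rewrite -scalerA -E scalerA mulVf ?scale1r // gt_eqF.
Qed.

Lemma ray_continuous v : v != 0 -> {for v, continuous ray}.
Proof.
move=> v0; apply: mx_continuous => i j; rewrite ord1.
have c k : {for v, continuous (fun w => w k 0)} by exact: coord_continuous.
rewrite (_ : (fun w => _) =
  (fun w => (Num.sqrt (w 0 0 * w 0 0 + w 1 0 * w 1 0))^-1 * w i 0)); last first.
  by apply/funext => w; rewrite mxE -!expr2.
apply: continuousM; last exact: c.
apply: continuousV; first by rewrite -!expr2 gt_eqF // sqrtr_gt0 norm2_gt0.
apply: (@continuous_comp 'cV[R]_2 R R (fun w => w 0 0 * w 0 0 + w 1 0 * w 1 0)
  Num.sqrt v);
  last exact: sqrt_continuous.
by apply: (@continuousD _ R^o); apply: continuousM; exact: c.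
Qed.

End Rays.

(** A topological loop on the punctured plane that is homogeneous under positive
    scaling in both arguments induces a topological loop on the circle of
    rays. *)
Section RayLoop.
Variables (R : realType) (mul : 'cV[R]_2 -> 'cV[R]_2 -> 'cV[R]_2).
Hypothesis tloop : topological_loop Qstar mul e1.
Hypothesis mulZl : forall (r : R) x y, 0 < r -> x != 0 -> y != 0 -> mul (r *: x)
  y = r *: mul x y.
Hypothesis mulZr : forall (r : R) x y, 0 < r -> x != 0 -> y != 0 -> mul x (r *: y)
  = r *: mul x y.

Let loopQ : is_loop Qstar mul e1.
Proof. by have [] := tloop. Qed.

(** The product of two rays, each represented by its point on the circle. *)
Definition ray_mul x y := ray (mul x y).

Lemma ray_within_continuous (f : 'cV[R]_2 * 'cV[R]_2 -> 'cV[R]_2) :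
  (forall x y, x != 0 -> y != 0 -> f (x, y) != 0) ->
  {within Qstar `*` Qstar, continuous f} ->
  {within @circle R `*` @circle R, continuous (fun p => ray (f p))}.
Proof.
move=> f0 cf.
have sub : @circle R `*` @circle R `<=` Qstar `*` Qstar.
  by move=> [x y] [/= cx cy]; split; exact: circle_neq0.
have := continuous_subspaceW sub cf.
move/subspace_continuousP => cf'; apply/subspace_continuousP => -[x y] [/= cx cy].
apply: (@cvg_comp _ _ _ f (@ray R) _ (nbhs (f (x, y)))); first exact: (cf' (x, y)).
by apply: ray_continuous; apply: f0; exact: circle_neq0.
Qed.

Lemma ray_loop : topological_loop (@circle R) ray_mul e1.
Proof.
have [_ cm [ld [rd [ldP rdP cld crd]]]] := tloop.
have m0 x y : x != 0 -> y != 0 -> mul x y != 0 by move=> x0 y0;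
  exact: (loop_closed loopQ).
have c0 := @circle_neq0 R.
have rloop_mul_inj x y z : x != 0 -> y != 0 -> z != 0 -> mul y x = mul z x -> y = z.
  move=> x0 y0 z0 E; have [w [_ uw]] := loop_rdiv loopQ x0 (m0 _ _ y0 x0).
  by rewrite -(uw y) // -(uw z).
have ldc x y : circle x -> circle y ->
    circle (ray (ld x y)) /\ ray_mul x (ray (ld x y)) = y.
  move=> cx cy; have [l0 lE] := ldP x y (c0 _ cx) (c0 _ cy).
  split; first exact: circle_ray.
  rewrite /ray_mul; have [s s0 ->] := ray_scale l0.
  by rewrite (mulZr s0 (c0 _ cx) l0) lE rayZ // ray_circle.
have rdc x y : circle x -> circle y ->
    circle (ray (rd x y)) /\ ray_mul (ray (rd x y)) x = y.
  move=> cx cy; have [l0 lE] := rdP x y (c0 _ cx) (c0 _ cy).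
  split; first exact: circle_ray.
  rewrite /ray_mul; have [s s0 ->] := ray_scale l0.
  by rewrite (mulZl s0 l0 (c0 _ cx)) lE rayZ // ray_circle.
have ce1 : circle (e1 : 'cV[R]_2)
  by rewrite /circle /= /e1 !mxE /= expr1n expr0n addr0.
split; first split.
- by move=> x y /c0 x0 /c0 y0; apply: circle_ray; exact: m0.
- exact: ce1.
- by move=> x cx; rewrite /ray_mul (loop_mul1l loopQ) ?ray_circle //; exact: c0.
- by move=> x cx; rewrite /ray_mul (loop_mul1r loopQ) ?ray_circle //; exact: c0.
- move=> x y cx cy; exists (ray (ld x y)); split; first exact: ldc.
  move=> z [cz zE]; have [cl lE] := ldc _ _ cx cy.
  have [[x0 z0] l0] := (c0 _ cx, c0 _ cz, c0 _ cl).
  have [|r r0 E] := ray_eq (m0 _ _ x0 l0) (m0 _ _ x0 z0);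
    first by rewrite -/(ray_mul _ _) lE.
  rewrite -(ray_circle cl) -(ray_circle cz) -(rayZ z r0); congr ray.
  apply: (loop_mul_inj loopQ x0 l0); last by rewrite mulZr.
  by rewrite /Qstar /= scaler_eq0 negb_or z0 gt_eqF.
- move=> x y cx cy; exists (ray (rd x y)); split; first exact: rdc.
  move=> z [cz zE]; have [cl lE] := rdc _ _ cx cy.
  have [[x0 z0] l0] := (c0 _ cx, c0 _ cz, c0 _ cl).
  have [|r r0 E] := ray_eq (m0 _ _ l0 x0) (m0 _ _ z0 x0);
    first by rewrite -/(ray_mul _ _) lE.
  rewrite -(ray_circle cl) -(ray_circle cz) -(rayZ z r0); congr ray.
  apply: (rloop_mul_inj x) => //; last by rewrite mulZl.
  by rewrite scaler_eq0 negb_or z0 gt_eqF.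
- exact: (@ray_within_continuous (fun p => mul p.1 p.2)).
- exists (fun x y => ray (ld x y)), (fun x y => ray (rd x y)); split => //.
  + apply: (@ray_within_continuous (fun p => ld p.1 p.2)) => // x y x0 y0.
    by have [] := ldP x y x0 y0.
  + apply: (@ray_within_continuous (fun p => rd p.1 p.2)) => // x y x0 y0.
    by have [] := rdP x y x0 y0.
Qed.

End RayLoop.

(** * The decomposition *)

Section Decomposition.
Variables (R : realType) (mul : 'cV[R]_2 -> 'cV[R]_2 -> 'cV[R]_2) (a b : R -> R -> R).
Hypothesis Hqf : topological_quasifield mul.
Hypothesis Hker : qf_kernel mul = [set k : 'cV[R]_2 | k 1 0 = 0].
Hypothesis Hlin : forall x, Qstar x -> linear (mul x).
Hypothesis Hab : section_functions a b.
Hypothesis Hsec : left_translations mul Qstar = section_matrices a b.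
Hypothesis homog : forall (r : R) (x : 'cV[R]_2), 0 < r -> x != 0 ->
  trans mul (r *: x) = r *: trans mul x.

Let scale_neq0 (r : R) (x : 'cV[R]_2) : 0 < r -> x != 0 -> r *: x != 0.
Proof. by move=> r0 x0; rewrite scaler_eq0 negb_or x0 gt_eqF. Qed.

(** The matrix of coordinates (u, t) divided by the scalar u, of determinant 1. *)
Definition unimodular_part (u t : R) : 'M[R]_2 :=
  Defs.rot t *m mx22 (a u t) (b u t) 0 (a u t)^-1.

Lemma section_translation u t : 0 < u -> 0 <= t < 2 * pi ->
  exists2 x, x != 0 & u *: unimodular_part u t = trans mul x.
Proof.
move=> u0 ht; have : section_matrices a b (u *: unimodular_part u t) by exists u, t.
by rewrite -Hsec (left_translationsE Hlin) // => -[x x0 <-]; exists x.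
Qed.

Lemma unimodular_part_indep u t : 0 < u -> 0 <= t < 2 * pi ->
  unimodular_part u t = unimodular_part 1 t.
Proof.
move=> u0 ht; have [_ _ _ apos _] := Hab.
have [x x0 xE] := section_translation u0 ht.
have ui0 : 0 < u^-1 by rewrite invr_gt0.
have E : 1 *: unimodular_part u t = trans mul (u^-1 *: x).
  by rewrite homog // -xE scalerA mulVf ?gt_eqF.
have [v [s [v0 hs sE]]] := trans_section Hlin Hsec (scale_neq0 ui0 x0).
rewrite sE in E.
have [v1 ts aE bE] := section_matrix_inj ltr01 v0 ht hs (apos _ t u0) (apos _ s v0) E.
by rewrite /unimodular_part aE bE -ts -v1.
Qed.

Lemma compact_factorE M : compact_factor a b M ->
  exists2 x, x != 0 & M = trans mul x.
Proof.
move=> [t ht ->]; have [x x0 xE] := section_translation ltr01 ht.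
by exists x => //; rewrite -xE scale1r.
Qed.

(** Up to a positive scalar, every left translation lies in the compact factor. *)
Lemma trans_compact_factor x : x != 0 ->
  exists2 u : R, 0 < u & compact_factor a b (u^-1 *: trans mul x).
Proof.
move=> x0; have [u [t [u0 ht ->]]] := trans_section Hlin Hsec x0.
exists u => //; exists t => //; rewrite scalerA mulVf ?gt_eqF // scale1r.
exact: unimodular_part_indep.
Qed.

Let mulZl (r : R) x y : 0 < r -> x != 0 -> y != 0 -> mul (r *: x) y = r *: mul x y.
Proof.
move=> r0 x0 y0; rewrite !(transE Hlin) //; last exact: scale_neq0.
by rewrite homog // -scalemxAl.
Qed.

Lemma compact_factor_loop : compact_loop_translations (compact_factor a b).
Proof.
exists (ray_mul mul); have [_ _ tloop] := Hqf.
have m0 x y : x != 0 -> y != 0 -> mul x y != 0.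
  by move=> x0 y0; have [lQ _ _] := tloop; exact: (loop_closed lQ).
split.
- by apply: ray_loop => // r x y _ x0 _; exact: (mulZr Hlin).
- move=> _ /compact_factorE [x x0 ->]; exists (ray x); first exact: circle_ray.
  move=> y /circle_neq0 y0; rewrite /ray_mul; have [s s0 ->] := ray_scale x0.
  by rewrite mulZl // rayZ // (transE Hlin).
- move=> x /circle_neq0 x0; have [u u0 Tu] := trans_compact_factor x0.
  exists (u^-1 *: trans mul x) => // y cy.
  rewrite /ray_mul (transE Hlin) // -/(ray _) -[RHS]/(ray _) -scalemxAl rayZ //.
  by rewrite invr_gt0.
Qed.

Lemma decomposable_of_homogeneous : decomposable mul a b.
Proof.
have [_ _ _ apos _] := Hab.
have e10 := @e1_neq0 R.
have transr r : 0 < r -> trans mul (r *: e1) = r%:M.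
  by move=> r0; rewrite homog // (trans_e1 Hqf Hlin) scalemx1.
rewrite /decomposable /= Hker.
(* K0 is the group of positive scalar matrices *)
have K0E : left_translations mul [set k : 'cV[R]_2 | k 1 0 = 0 /\ 0 < k 0 0] =
    [set r%:M | r in [set r : R | 0 < r]].
  rewrite (left_translationsE Hlin); last first.
    by move=> k [_ k0]; apply/eqP => kE; move: k0; rewrite kE mxE ltxx.
  have kE (k : 'cV[R]_2) : k 1 0 = 0 -> k = k 0 0 *: e1.
    by move=> k1; apply: cV2P; rewrite !mxE /= ?mulr1 ?mulr0 ?k1.
  apply/seteqP; split => [_ [k [k1 k0] <-]|_ [r r0 <-]].
    by exists (k 0 0) => //; rewrite -transr // -kE.
  by exists (r *: e1); rewrite ?transr //= !mxE /= mulr0 mulr1.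
split.
- exact: compact_factor_loop.
- rewrite (left_translationsE Hlin) // K0E; apply/seteqP; split.
    move=> _ [x x0 <-]; have [u u0 Tu] := trans_compact_factor x0.
    exists (u^-1 *: trans mul x) => //; exists u%:M; first by exists u.
    by rewrite mul_mx_scalar scalerA mulfV ?scale1r // gt_eqF.
  move=> _ [_ /compact_factorE [x x0 ->]] [_ [r r0 <-] <-].
  exists (r *: x); first exact: scale_neq0.
  by rewrite homog // mul_mx_scalar.
- apply: (@card_le_trans _ _ _ ((fun n : nat => unimodular_part 1 (n%:R * pi))
    @` `I_2));
    last exact: card_image_le.
  (* a common element maps e1 into the axis, so that t = 0 or t = pi *)
  apply: subset_card_le => _ [[t ht ->]].
  rewrite (left_translationsE Hlin); last by move=> k [].
  move=> [k [k1 k0] kE].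
  have st : sin t = 0.
    have := trans_mul_e1 Hqf Hlin k0; rewrite kE => /matrixP/(_ 1 0).
    rewrite k1 mulmx_e1 mulmx_22 !mxE /= mulr0 addr0 => /eqP.
    by rewrite mulf_eq0 oppr_eq0 (gt_eqF (apos _ _ ltr01)) orbF => /eqP.
  have [->|->] := sin_eq0_0pi ht st; [exists 0%N|exists 1%N] => //.
    by rewrite mul0r.
  by rewrite mul1r.
Qed.

End Decomposition.

Theorem theorem12 (R : realType)
    (mul : 'cV[R]_2 -> 'cV[R]_2 -> 'cV[R]_2) (a b : R -> R -> R)
    (Hqf : topological_quasifield mul)
    (Hker : qf_kernel mul = [set k : 'cV[R]_2 | k 1 0 = 0])
    (Hlin : forall x, Qstar x -> linear (mul x))
    (Hgen : topologically_generates_GL2p (left_translations mul Qstar))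
    (Hab : section_functions a b)
    (Hsec : left_translations mul Qstar = section_matrices a b) :
  ~ quasi_simple Qstar mul e1 -> decomposable mul a b.
Proof.
move=> /contrapT [N [normN NneqQ dimN]].
apply: decomposable_of_homogeneous => // r x r0 x0.
have axisN := normal_proper_axis Hqf Hlin Hgen (trans_polar Hqf Hlin Hab Hsec)
  normN NneqQ.
apply: (trans_homogeneous Hqf Hlin Hgen normN axisN) => //.
exact: (normal_axis_positive Hqf Hlin normN axisN dimN).
Qed.
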